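(* Let $\Omega\subset\mathbb R^2$ be a bounded domain with smooth boundary and let $\omega\ne 0$ be a real number. Let $u\in C^2(\Omega)\cap C(\overline\Omega)$ be a complex-valued function, not identically zero, satisfying $\Delta u-i\omega u=0$ in $\Omega$. Then $|u|^2$ is a non-constant subharmonic function on $\Omega$.
   Context: A real-valued function $v\in C^2(\Omega)$ is called subharmonic if $\Delta v(x)\ge 0$ for all $x\in\Omega$. A domain is a connected open set. *)

(* Defs.v *)
From HB Require Import structures.
From mathcomp Require Import all_boot all_order all_algebra.
From mathcomp Require Import all_classical all_reals all_analysis.
From mathcomp Require Export complex.
Import Order.TTheory GRing.Theory Num.Theory.
Import numFieldNormedType.Exports.

Set Implicit Arguments.
Unset Strict Implicit.
Unset Printing Implicit Defensive.

Local Open Scope classical_set_scope.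
Local Open Scope ring_scope.

Definition domain (R : realType) (n : nat) (Om : set 'rV[R]_n) : Prop :=
  open Om /\ connected Om.

Definition boundary (T : topologicalType) (A : set T) : set T :=
  closure A `\` interior A.

Definition smooth_fun (R : realType) (g : R -> R) : Prop :=
  forall (k : nat) (t : R), derivable (derive1n k g) t 1.

(* Near each boundary point, after possibly exchanging the two coordinate axes
   (choice of [i] and [j]) and reversing one of them (sign [s]), [Om] is the
   set of points lying above the graph of a C^oo function of one variable. *)
Definition smooth_boundary (R : realType) (Om : set 'rV[R]_2) : Prop :=
  forall p, boundary Om p ->
    exists (r : R) (g : R -> R) (i j : 'I_2) (s : bool),
      [/\ 0 < r, smooth_fun g, i != j &
          Om `&` ball p r =
          [set x | ball p r x /\ 0 < (-1) ^+ s * (x 0 j - g (x 0 i))]].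

Definition partial (R : realType) (n : nat) (j : 'I_n) (f : 'rV[R]_n -> R) :
    'rV[R]_n -> R :=
  fun x => derive f x (delta_mx 0 j).

(* C^k(Om) for [Om] open: all the partial derivatives of order at most [k]
   exist and are continuous on [Om]. *)
Fixpoint Ck (R : realType) (n k : nat) (Om : set 'rV[R]_n) (f : 'rV[R]_n -> R) :
    Prop :=
  (forall x, Om x -> {for x, continuous f}) /\
  (if k is k'.+1 then
     forall j : 'I_n, (forall x, Om x -> derivable f x (delta_mx 0 j)) /\
                      Ck k' Om (partial j f)
   else True).

Definition laplacian (R : realType) (n : nat) (f : 'rV[R]_n -> R) :
    'rV[R]_n -> R :=
  fun x => \sum_(j < n) partial j (partial j f) x.

(* Continuity and differentiability of complex-valued functions are those of
   their real and imaginary parts. *)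
Definition continuous_on_complex (R : realType) (n : nat) (A : set 'rV[R]_n)
    (u : 'rV[R]_n -> R[i]) : Prop :=
  {within A, continuous (fun x => complex.Re (u x))} /\
  {within A, continuous (fun x => complex.Im (u x))}.

Definition Ck_complex (R : realType) (n k : nat) (Om : set 'rV[R]_n)
    (u : 'rV[R]_n -> R[i]) : Prop :=
  Ck k Om (fun x => complex.Re (u x)) /\ Ck k Om (fun x => complex.Im (u x)).

Definition laplacian_complex (R : realType) (n : nat) (u : 'rV[R]_n -> R[i]) :
    'rV[R]_n -> R[i] :=
  fun x => Complex (laplacian (fun y => complex.Re (u y)) x)
                   (laplacian (fun y => complex.Im (u y)) x).

Definition subharmonic (R : realType) (n : nat) (Om : set 'rV[R]_n)
    (v : 'rV[R]_n -> R) : Prop :=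
  Ck 2 Om v /\ forall x, Om x -> 0 <= laplacian v x.

Definition constant_on (T S : Type) (A : set T) (v : T -> S) : Prop :=
  exists c : S, forall x, A x -> v x = c.

(* Main.v *)
(* Write u = a + i b, so that lap a = - omega b and lap b = omega a. Then
   a lap a + b lap b = 0, and lap |u|^2 = 2 (|grad a|^2 + |grad b|^2) >= 0.
   If |u|^2 is constant, both gradients vanish on Om, hence so do lap a and
   lap b, hence so does u since omega <> 0; by continuity u = 0 on the
   closure. *)
Require Import Defs.
From mathcomp Require Import all_boot all_order all_algebra.
From mathcomp Require Import all_classical all_reals all_analysis.
From mathcomp Require Import ring.
Import Order.TTheory GRing.Theory Num.Theory.
Import numFieldNormedType.Exports.
Local Open Scope classical_set_scope.
Local Open Scope ring_scope.
Local Open Scope complex_scope.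

Set Implicit Arguments.
Unset Strict Implicit.
Unset Printing Implicit Defensive.

Lemma near_eq_on (T : topologicalType) (S : Type) (A : set T) (f g : T -> S)
    (x : T) :
  open A -> (forall y, A y -> f y = g y) -> A x -> \near x, f x = g x.
Proof.
move=> oA fg Ax; have := open_nbhs_nbhs (conj oA Ax).
exact: filterS.
Qed.

Section Ck_theory.
Variables (R : realType) (n : nat) (A : set 'rV[R]_n).
Hypothesis oA : open A.
Implicit Types f g : 'rV[R]_n -> R.

Lemma partial_eq_on f g j :
  (forall y, A y -> f y = g y) ->
  forall x, A x -> partial j f x = partial j g x.
Proof.
by move=> fg x Ax; apply: near_eq_derive; exact: near_eq_on oA fg Ax.
Qed.

Lemma partial_cst_on f j (c : R) :
  (forall y, A y -> f y = c) -> forall x, A x -> partial j f x = 0.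
Proof.
move=> fc x Ax; rewrite (@partial_eq_on f (cst c) j)//.
exact: derive_cst.
Qed.

Lemma laplacian_cst_on f (c : R) :
  (forall y, A y -> f y = c) -> forall x, A x -> laplacian f x = 0.
Proof.
move=> fc x Ax; apply: big1 => j _.
by apply: (@partial_cst_on _ j 0) => // y; exact: partial_cst_on fc _.
Qed.

Lemma Ck_continuous k f x : Ck k A f -> A x -> {for x, continuous f}.
Proof. by case: k => [|k] [+ _]; exact. Qed.

(** Since [A] is open, agreement on [A] is agreement near [x], so continuity, a local property,
    transfers. *)
Lemma continuous_eq_on f g x :
  (forall y, A y -> f y = g y) -> A x ->
  {for x, continuous f} -> {for x, continuous g}.
Proof.
move=> fg Ax; rewrite /prop_for /continuous_at -(fg x Ax).
exact: cvg_trans (near_eq_cvg (near_eq_on oA fg Ax)).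
Qed.

(** Serves [CkD] and [CkM]: the sum and product rules identify the partial derivatives only at
    points of [A], where derivability is known, so the formulas can replace them only on [A]. *)
Lemma Ck_eq_on k f g :
  (forall y, A y -> f y = g y) -> Ck k A f -> Ck k A g.
Proof.
elim: k f g => [|k IHk] f g fg Cf.
  by split=> // x Ax; exact: continuous_eq_on fg Ax (Ck_continuous Cf Ax).
split=> [x Ax|j].
  exact: continuous_eq_on fg Ax (Ck_continuous Cf Ax).
have [dfj Cfj] := Cf.2 j; split.
  move=> x Ax; apply: near_eq_derivable (dfj x Ax).
  exact: near_eq_on oA fg Ax.
by apply: IHk Cfj => y; exact: partial_eq_on.
Qed.

Lemma CkS k f : Ck k.+1 A f -> Ck k A f.
Proof.
elim: k f => [|k IHk] f [cf df]; split=> // j.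
by have [dfj Cfj] := df j; split=> //; exact: IHk.
Qed.

Lemma Ck_derivable k f j x : Ck k.+1 A f -> A x ->
  derivable f x (delta_mx 0 j).
Proof. by move=> [_ /(_ j)[+ _]]; exact. Qed.

Lemma Ck_partial k f j : Ck k.+1 A f -> Ck k A (partial j f).
Proof. by move=> [_ /(_ j)[]]. Qed.

Lemma partialD f g j x :
  derivable f x (delta_mx 0 j) -> derivable g x (delta_mx 0 j) ->
  partial j (f + g) x = partial j f x + partial j g x.
Proof. exact: deriveD. Qed.

Lemma partialM f g j x :
  derivable f x (delta_mx 0 j) -> derivable g x (delta_mx 0 j) ->
  partial j (f * g) x = f x * partial j g x + g x * partial j f x.
Proof. exact: deriveM. Qed.

Lemma CkD k f g : Ck k A f -> Ck k A g -> Ck k A (f + g).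
Proof.
elim: k f g => [|k IHk] f g Cf Cg.
  split=> [x Ax|]; last exact: I.
  exact: (continuousD (Ck_continuous Cf Ax) (Ck_continuous Cg Ax)).
split=> [x Ax|j].
  exact: (continuousD (Ck_continuous Cf Ax) (Ck_continuous Cg Ax)).
split=> [x Ax|].
  exact: (derivableD (Ck_derivable Cf Ax) (Ck_derivable Cg Ax)).
apply: (@Ck_eq_on _ (partial j f + partial j g)).
  move=> y Ay.
  by rewrite (partialD (Ck_derivable Cf Ay) (Ck_derivable Cg Ay)).
by apply: IHk; [exact: Ck_partial j Cf|exact: Ck_partial j Cg].
Qed.

Lemma CkM k f g : Ck k A f -> Ck k A g -> Ck k A (f * g).
Proof.
elim: k f g => [|k IHk] f g Cf Cg.
  split=> [x Ax|]; last exact: I.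
  exact: (continuousM (Ck_continuous Cf Ax) (Ck_continuous Cg Ax)).
split=> [x Ax|j].
  exact: (continuousM (Ck_continuous Cf Ax) (Ck_continuous Cg Ax)).
split=> [x Ax|].
  exact: (derivableM (Ck_derivable Cf Ax) (Ck_derivable Cg Ax)).
apply: (@Ck_eq_on _ (f * partial j g + g * partial j f)).
  move=> y Ay.
  by rewrite (partialM (Ck_derivable Cf Ay) (Ck_derivable Cg Ay)).
(* The product rule mixes [f] and [g], of order [k.+1], with partial derivatives of order [k]; [CkS]
   lowers the former so that the induction hypothesis applies. *)
apply: CkD; apply: IHk; first exact: CkS Cf.
- exact: Ck_partial j Cg.
- exact: CkS Cg.
- exact: Ck_partial j Cf.
Qed.

Lemma laplacianD f g x : Ck 2 A f -> Ck 2 A g -> A x ->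
  laplacian (f + g) x = laplacian f x + laplacian g x.
Proof.
move=> Cf Cg Ax; rewrite /laplacian -big_split/=; apply: eq_bigr => j _.
rewrite (@partial_eq_on _ (partial j f + partial j g))//.
  exact: partialD (Ck_derivable (Ck_partial j Cf) Ax)
                  (Ck_derivable (Ck_partial j Cg) Ax).
move=> y Ay.
by rewrite (partialD (Ck_derivable Cf Ay) (Ck_derivable Cg Ay)).
Qed.

(** Product rule twice: the first partial derivative of the square is twice [f * partial j f], and
    differentiating this produces the squared gradient term. *)
Lemma laplacian_sqr f x : Ck 2 A f -> A x ->
  laplacian (f * f) x =
  (f x * laplacian f x + \sum_(j < n) partial j f x ^+ 2) *+ 2.
Proof.
move=> Cf Ax.
rewrite /laplacian mulr_sumr -big_split/= -sumrMnl; apply: eq_bigr => j _.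
have df y : A y -> derivable f y (delta_mx 0 j).
  by move=> Ay; exact: Ck_derivable Cf Ay.
have ddf : derivable (partial j f) x (delta_mx 0 j).
  exact: Ck_derivable (Ck_partial j Cf) Ax.
have dfM := derivableM (df x Ax) ddf.
(* The inner derivative is replaced on all of [A], not just at [x], because it is differentiated
   again. *)
rewrite (@partial_eq_on _ (f * partial j f + f * partial j f))//.
  rewrite (partialD dfM dfM) (partialM (df x Ax) ddf).
  ring.
by move=> y Ay; rewrite (partialM (df y Ay) (df y Ay)).
Qed.

End Ck_theory.

(** If [f x] were nonzero, [f] would be nonzero near [x] relative to the closure, yet every
    neighbourhood of [x] meets [A]. *)
Lemma within_continuous_closure_eq0 (T : topologicalType) (R : realType)
    (A : set T) (f : T -> R) :
  {within closure A, continuous f} -> (forall x, A x -> f x = 0) ->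
  forall x, closure A x -> f x = 0.
Proof.
move=> cf f0 x Ax; apply/eqP/negPn/negP => fx0.
have : \forall y \near within (closure A) (nbhs x), f y != 0.
  have := cf x; rewrite /continuous_at /= nbhs_subspace_in// => cfx.
  apply: (cfx [set r | r != 0]).
  exact: (open_nbhs_nbhs (conj (@open_neq _ 0) fx0)).
move=> /Ax[y [Ay /(_ (subset_closure Ay))]].
by rewrite f0// eqxx.
Qed.

(** Removes the square root, so that [CkM] and [CkD] give the regularity of the squared modulus. *)
Lemma normc_sqr (R : rcfType) (z : R[i]) :
  Normc.normc z ^+ 2 =
  complex.Re z * complex.Re z + complex.Im z * complex.Im z.
Proof. by case: z => a b /=; rewrite sqr_sqrtr ?addr_ge0 ?sqr_ge0// !expr2. Qed.

(* Functions on the closure of Om are total functions restricted to it: only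
   the values of u on closure Om matter. *)
Theorem theorem5 (R : realType) (Om : set 'rV[R]_2) (omega : R)
    (u : 'rV[R]_2 -> R[i])
    (Om_domain : domain Om)
    (Om_bounded : bounded_set Om)
    (Om_smooth : smooth_boundary Om)
    (omega_neq0 : omega != 0)
    (u_C2 : Ck_complex 2 Om u)
    (u_cont : continuous_on_complex (closure Om) u)
    (u_neq0 : exists2 x, closure Om x & u x != 0)
    (u_eq : forall x, Om x ->
       laplacian_complex u x - 'i%C * omega%:C * u x = 0) :
  let v : 'rV[R]_2 -> R := fun x => (Normc.normc (u x)) ^+ 2 in
  subharmonic Om v /\ ~ constant_on Om v.
Proof.
move=> v; have oOm := Om_domain.1.
pose a x := complex.Re (u x); pose b x := complex.Im (u x).
have [Ca Cb] : Ck 2 Om a /\ Ck 2 Om b := u_C2.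
have lap_ab x : Om x ->
    laplacian a x = - (omega * b x) /\ laplacian b x = omega * a x.
  move=> Omx; have /eqP := u_eq x Omx; rewrite subr_eq0 => /eqP.
  rewrite /laplacian_complex -/a -/b /a /b; case: (u x) => p q /= [-> ->].
  by split; ring.
have Caa := CkM oOm Ca Ca; have Cbb := CkM oOm Cb Cb.
have vE : v = a * a + b * b by apply/funext => x; exact: normc_sqr.
have grad_ge0 (f : 'rV[R]_2 -> R) x : 0 <= \sum_(j < 2) partial j f x ^+ 2.
  by apply: sumr_ge0 => j _; exact: sqr_ge0.
have lap_v x : Om x -> laplacian v x =
    (\sum_(j < 2) partial j a x ^+ 2 + \sum_(j < 2) partial j b x ^+ 2) *+ 2.
  move=> Omx; rewrite vE (laplacianD oOm Caa Cbb Omx).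
  rewrite (laplacian_sqr oOm Ca Omx) (laplacian_sqr oOm Cb Omx).
  by have [-> ->] := lap_ab x Omx; ring.
split; first split.
- by rewrite vE; exact: CkD oOm _ _ _ Caa Cbb.
- by move=> x Omx; rewrite lap_v// mulrn_wge0// addr_ge0.
move=> [c v_cst].
have grad0 j x : Om x -> partial j a x = 0 /\ partial j b x = 0.
  move=> Omx; have /eqP := laplacian_cst_on oOm v_cst Omx.
  (* A vanishing sum of nonnegative terms: first both squared gradients vanish, then each squared
     partial derivative. *)
  rewrite lap_v// mulrn_eq0/= paddr_eq0// => /andP[].
  rewrite !psumr_eq0; try by move=> k _; exact: sqr_ge0.
  move=> /allP/(_ j (mem_index_enum j))/=; rewrite sqrf_eq0 => /eqP->.
  by move=> /allP/(_ j (mem_index_enum j))/=; rewrite sqrf_eq0 => /eqP->.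
have [a0 b0] : (forall x, Om x -> a x = 0) /\ (forall x, Om x -> b x = 0).
  have lap0 (f : 'rV[R]_2 -> R) x : (forall j y, Om y -> partial j f y = 0) ->
      Om x -> laplacian f x = 0.
    move=> f0 Omx; apply: big1 => j _.
    exact: (@partial_cst_on _ _ _ oOm (partial j f) j 0 (f0 j) x Omx).
  (* The equations are coupled crosswise: [a] vanishes because the laplacian of [b] does, and
     conversely. *)
  split=> x Omx; have [la lb] := lap_ab x Omx; apply/eqP.
    have /eqP := lap0 b x (fun j y h => (grad0 j y h).2) Omx.
    by rewrite lb mulf_eq0 (negbTE omega_neq0).
  have /eqP := lap0 a x (fun j y h => (grad0 j y h).1) Omx.
  by rewrite la oppr_eq0 mulf_eq0 (negbTE omega_neq0).
(* The point where [u] is nonzero may lie on the boundary, hence the passage to the closure. *)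
have [x clx /eqP] := u_neq0; apply.
have := within_continuous_closure_eq0 u_cont.1 a0 clx.
have := within_continuous_closure_eq0 u_cont.2 b0 clx.
by case: (u x) => p q /= -> ->.
Qed.
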